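(* Let $D_1$ and $D_2$ be simple digraphs on $n_1$ and $n_2$ vertices, with $D_1$ having $m_1$ arcs, and let $G_1=U(D_1)$ be the underlying graph of $D_1$, with $m_1'$ edges. Then (i) $\displaystyle f_{Q(D_1 \overrightarrow{\diamond} D_2)} (\lambda)= \big[f_{Q(D_2)}(\lambda-1)\big]^{m_1} \det\left(\lambda I_{n_1}-\big(Q(D_1)+n_2D_{\rm out}(D_1)\big)-\chi_{Q(D_2)}(\lambda-1)\,A(D_1)\right)$, (ii) $\displaystyle f_{Q(D_1 \overleftarrow{\diamond} D_2)}(\lambda)= \big[f_{Q(D_2)}(\lambda-1)\big]^{m_1} \det\left(\lambda I_{n_1}-\big(Q(D_1)+n_2D_{\rm in}(D_1)\big)-\chi_{Q(D_2)}(\lambda-1)\,A(D_1)^T\right)$, (iii) $\displaystyle f_{Q(D_1 \overleftrightarrow{\diamond} D_2)}(\lambda)= \big[f_{Q(D_2)}(\lambda-2)\big]^{m_1'}\det\left(\lambda I_{n_1}-\big(Q(D_1)+n_2D_{\rm deg}(G_1)\big)-\chi_{Q(D_2)}(\lambda-2)\,Q(G_1)\right)$.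
   Context: Digraphs are simple. $A(D)$ is the adjacency matrix, $D_{\rm out}(D)$ and $D_{\rm in}(D)$ the diagonal out-degree and in-degree matrices, $Q(D)=D_{\rm out}(D)+A(D)$. The underlying graph $U(D)$ has an edge $\{u,v\}$ whenever $uv$ or $vu$ is an arc; for a graph $G$, $D_{\rm deg}(G)$ is the diagonal degree matrix and $Q(G)=D_{\rm deg}(G)+A(G)$. $f_M(\lambda)=\det(\lambda I-M)$; for a real $n\times n$ matrix $M$ over $\mathbb{C}(\lambda)$, $\chi_M(\lambda)=\mathbf{1}_n^T(\lambda I_n-M)^{-1}\mathbf{1}_n$ ($\mathbf{1}_n$ the all-ones vector). Forward-arc-corona $D_1 \overrightarrow{\diamond} D_2$: one copy of $D_1$ and $m_1$ disjoint copies of $D_2$, one per arc; for each arc $a_k=uv$ and each vertex $w$ of the $k$-th copy add arcs $uw$ and $wv$. Backward-arc-corona $D_1 \overleftarrow{\diamond} D_2$: same, but add arcs $vw$ and $wu$. Symmetric-arc-corona $D_1 \overleftrightarrow{\diamond} D_2$: one copy of $D_1$ and one copy of $D_2$ per edge of $U(D_1)$; for each edge $\{u,v\}$ and each vertex $w$ of the corresponding copy add arcs $uw,wu,vw,wv$. *)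

(* Defs.v *)
From HB Require Import structures.
From mathcomp Require Import all_boot all_order all_algebra.
From mathcomp Require Import reals complex.

Set Implicit Arguments.
Unset Strict Implicit.
Unset Printing Implicit Defensive.

Import GRing.Theory.
Local Open Scope ring_scope.
Local Open Scope complex_scope.

(* No loops and no multiple arcs; a pair of opposite arcs uv, vu is allowed. *)
Record digraph := Digraph {
  vertex :> finType;
  arc : rel vertex;
  arc_irr : irreflexive arc }.

Record sgraph := SGraph {
  node :> finType;
  adj : rel node;
  adj_irr : irreflexive adj;
  adj_sym : symmetric adj }.

Definition arcs (D : digraph) : {set D * D} := [set a | arc a.1 a.2].

Definition edges (G : sgraph) : {set {set G}} :=
  [set [set p.1; p.2] | p in [set p : G * G | adj p.1 p.2]].

Section Underlying.
Variable D : digraph.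

Definition ug_adj : rel D := fun u v => arc u v || arc v u.

Lemma ug_adj_irr : irreflexive ug_adj.
Proof. by move=> u; rewrite /ug_adj !arc_irr. Qed.

Lemma ug_adj_sym : symmetric ug_adj.
Proof. by move=> u v; rewrite /ug_adj orbC. Qed.

Definition underlying : sgraph := SGraph ug_adj_irr ug_adj_sym.

End Underlying.

(* In the three coronas, [inl u] is the vertex u of D1 and [inr (k, w)] is the
   vertex w of the copy of D2 attached to the arc (or edge) k. *)
Section Coronas.
Variables D1 D2 : digraph.

Definition arc_corona_vertex : finType :=
  (D1 + {a : D1 * D1 | a \in arcs D1} * D2)%type.

Definition edge_corona_vertex : finType :=
  (D1 + {e : {set D1} | e \in edges (underlying D1)} * D2)%type.

Definition fwd_arc : rel arc_corona_vertex := fun x y =>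
  match x, y with
  | inl u, inl v => arc u v
  | inl u, inr (a, _) => u == (val a).1
  | inr (a, _), inl v => v == (val a).2
  | inr (a, w), inr (b, w') => (a == b) && arc w w'
  end.

Definition bwd_arc : rel arc_corona_vertex := fun x y =>
  match x, y with
  | inl u, inl v => arc u v
  | inl v, inr (a, _) => v == (val a).2
  | inr (a, _), inl u => u == (val a).1
  | inr (a, w), inr (b, w') => (a == b) && arc w w'
  end.

Definition sym_arc : rel edge_corona_vertex := fun x y =>
  match x, y with
  | inl u, inl v => arc u v
  | inl u, inr (e, _) => u \in val e
  | inr (e, _), inl u => u \in val e
  | inr (e, w), inr (e', w') => (e == e') && arc w w'
  end.

Lemma fwd_arc_irr : irreflexive fwd_arc.
Proof. by case=> [u|[a w]] /=; rewrite arc_irr ?andbF. Qed.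

Lemma bwd_arc_irr : irreflexive bwd_arc.
Proof. by case=> [u|[a w]] /=; rewrite arc_irr ?andbF. Qed.

Lemma sym_arc_irr : irreflexive sym_arc.
Proof. by case=> [u|[e w]] /=; rewrite arc_irr ?andbF. Qed.

Definition forward_arc_corona : digraph := Digraph fwd_arc_irr.
Definition backward_arc_corona : digraph := Digraph bwd_arc_irr.
Definition symmetric_arc_corona : digraph := Digraph sym_arc_irr.

End Coronas.

(* The field C(lambda), where C = R[i]. *)
Notation ratfun R := {fraction {poly (complex R)}}.

(* Vertices are numbered by [enum_val]; f_M and chi_M do not depend on the
   numbering. *)
Section Matrices.
Variable R : realType.

Definition outdeg (D : digraph) (u : D) : nat := #|[set v | arc u v]|.
Definition indeg (D : digraph) (u : D) : nat := #|[set v | arc v u]|.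
Definition deg (G : sgraph) (u : G) : nat := #|[set v | adj u v]|.

Definition adjmx (D : digraph) : 'M[R]_#|D| :=
  \matrix_(i, j) (arc (enum_val i) (enum_val j))%:R.
Definition outdegmx (D : digraph) : 'M[R]_#|D| :=
  diag_mx (\row_i (outdeg (enum_val i))%:R).
Definition indegmx (D : digraph) : 'M[R]_#|D| :=
  diag_mx (\row_i (indeg (enum_val i))%:R).
Definition Qmx (D : digraph) : 'M[R]_#|D| := outdegmx D + adjmx D.

Definition gadjmx (G : sgraph) : 'M[R]_#|G| :=
  \matrix_(i, j) (adj (enum_val i) (enum_val j))%:R.
Definition gdegmx (G : sgraph) : 'M[R]_#|G| :=
  diag_mx (\row_i (deg (enum_val i))%:R).
Definition gQmx (G : sgraph) : 'M[R]_#|G| := gdegmx G + gadjmx G.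

Definition lambda : ratfun R := tofrac 'X.

Definition real_ratfun : {rmorphism R -> ratfun R} :=
  @tofrac {poly R[i]} \o polyC \o real_complex R.

Definition liftmx m n (M : 'M[R]_(m, n)) : 'M[ratfun R]_(m, n) :=
  map_mx real_ratfun M.

(* f_M and chi_M are taken as functions of t in C(lambda), so that
   f_M(lambda - c) and chi_M(lambda - c) are their values at t = lambda - c. *)
Definition charpol n (M : 'M[R]_n) (t : ratfun R) : ratfun R :=
  (map_poly real_ratfun (char_poly M)).[t].

Definition coronal n (M : 'M[R]_n) (t : ratfun R) : ratfun R :=
  ((const_mx 1 : 'rV_n) *m invmx (t%:M - liftmx M)
    *m (const_mx 1 : 'cV_n)) 0 0.

Lemma charpolE n (M : 'M[R]_n) t : charpol M t = \det (t%:M - liftmx M).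
Proof.
rewrite /charpol map_char_poly /char_poly -horner_evalE -det_map_mx.
congr (\det _); apply/matrixP=> i j.
by rewrite !mxE /= /horner_eval hornerD hornerN hornerMn hornerX hornerC.
Qed.

Lemma charpol_shift n (M : 'M[R]_n) (c : nat) :
  charpol M (lambda - c%:R) =
  tofrac (char_poly (map_mx (real_complex R) M) \Po ('X - c%:R%:P)).
Proof.
have -> : lambda - c%:R = tofrac ('X - c%:R%:P).
  by rewrite rmorphB /= polyC_natr rmorph_nat.
rewrite /charpol -map_char_poly /comp_poly -horner_map -!map_poly_comp.
by congr (_.[_]).
Qed.

(* [invmx] in [coronal] is the true inverse at every argument that is used. *)
Lemma coronal_unitmx n (M : 'M[R]_n) (c : nat) :
  (lambda - c%:R)%:M - liftmx M \in unitmx.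
Proof.
rewrite unitmxE unitfE -charpolE charpol_shift tofrac_eq0.
rewrite -size_poly_eq0 size_comp_poly2 ?size_XsubC // size_poly_eq0.
exact: monic_neq0 (char_poly_monic _).
Qed.

End Matrices.

(* Main.v *)
Require Import Defs.
From mathcomp Require Import all_boot all_order all_algebra all_fingroup.
From mathcomp Require Import reals complex ring.

Import GRing.Theory.
Local Open Scope ring_scope.

Set Implicit Arguments.
Unset Strict Implicit.

(** In each corona, the rows of lambda - Q indexed by the copies of D2 form a
block diagonal matrix with every block equal to N = (lambda - s) - Q(D2), where
s is the number of arcs from a vertex of a copy back to D1 (1 or 2). Its Schur
complement is det N once per copy, times the determinant of the D1-block minus
chi_{Q(D2)}(lambda - s) times the matrix counting, for u and v in D1, the copies
k with arcs from u to copy k and from copy k to v. That matrix is A(D1), A(D1)^T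
and Q(U(D1)) respectively. *)

(** * Determinants of matrices indexed by finite types *)

(** Entries given by a function of vertices, not of ordinals, let sums and products of vertex types
    be handled by case analysis. *)
Definition finmx (F : fieldType) (T : finType) (f : T -> T -> F) :
    'M[F]_#|T| :=
  \matrix_(i, j) f (enum_val i) (enum_val j).

(** Renumbering applies one and the same permutation to rows and columns, so its sign occurs twice
    and cancels. *)
Lemma det_relabel (F : fieldType) (n : nat) (T : finType) (g : 'I_n -> T)
    (f : T -> T -> F) :
  bijective g -> \det (\matrix_(i, j) f (g i) (g j)) = \det (finmx f).
Proof.
move=> bij_g.
have En : n = #|T| by rewrite -(bij_eq_card bij_g) card_ord.
move: g bij_g; rewrite {}En => g bij_g.
have inj_s : injective (fun i => enum_rank (g i)).
  by apply: inj_comp; [exact: enum_rank_inj | exact: bij_inj].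
have -> : \matrix_(i, j) f (g i) (g j)
            = row_perm (perm inj_s) (col_perm (perm inj_s) (finmx f)).
  by apply/matrixP=> i j; rewrite !mxE !permE !enum_rankK.
rewrite row_permE col_permE !det_mulmx !det_perm odd_permV.
by rewrite mulrCA -signr_addb addbb mulr1.
Qed.

Lemma det_finmx_bij (F : fieldType) (S T : finType) (g : S -> T)
    (f : T -> T -> F) :
  bijective g -> \det (finmx (fun x y => f (g x) (g y))) = \det (finmx f).
Proof.
move=> bij_g.
by apply: (@det_relabel _ _ _ (g \o enum_val)) (bij_comp _ (enum_val_bij S)).
Qed.

(** The block matrix factors as a block upper triangular matrix, with the Schur complement and [D]
    on its diagonal, times a block lower unitriangular one. *)
Lemma det_schur (F : fieldType) (m n : nat) (A : 'M[F]_m) (B : 'M_(m, n))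
    (C : 'M_(n, m)) (D : 'M_n) :
  D \in unitmx ->
  \det (block_mx A B C D) = \det D * \det (A - B *m invmx D *m C).
Proof.
move=> unitD.
have -> : block_mx A B C D
    = block_mx (A - B *m invmx D *m C) B 0 D
      *m block_mx 1%:M 0 (invmx D *m C) 1%:M.
  by rewrite mulmx_block !mulmx1 !mulmx0 !add0r !mulmxA subrK mulmxV ?mul1mx.
by rewrite det_mulmx det_ublock det_lblock !det1 !mulr1 mulrC.
Qed.

(** The Schur complement is spelled out as a double sum, so that it can be evaluated entry by entry
    when [f] is defined by cases. *)
Lemma det_finmx_sum (F : fieldType) (S T : finType)
    (f : S + T -> S + T -> F) (D := finmx (fun x y => f (inr x) (inr y))) :
  D \in unitmx ->
  \det (finmx f) = \det D * \det (finmx (fun x y => f (inl x) (inl y) -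
    \sum_i \sum_j f (inl x) (inr (enum_val i)) * invmx D i j
                  * f (inr (enum_val j)) (inl y))).
Proof.
move=> unitD.
(* Listing [S] before [T] turns the two summands of the type into blocks. *)
pose g (i : 'I_(#|S| + #|T|)) : S + T :=
  match split i with inl j => inl (enum_val j) | inr j => inr (enum_val j) end.
have inj_g : injective g.
  move=> i j; rewrite /g => Eij; apply: (can_inj splitK); move: Eij.
  by case: (split i) => k; case: (split j) => l // [] /enum_val_inj ->.
have bij_g : bijective g by apply: inj_card_bij => //; rewrite card_ord card_sum.
rewrite -(det_relabel _ bij_g).
have gl i : g (lshift _ i) = inl (enum_val i) by rewrite /g (unsplitK (inl i)).
have gr i : g (rshift _ i) = inr (enum_val i) by rewrite /g (unsplitK (inr i)).
set M := \matrix_(i, j) _.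
have drM : drsubmx M = D by apply/matrixP=> i j; rewrite !mxE !gr.
rewrite -[M]submxK det_schur drM //; congr (_ * \det _); apply/matrixP=> i j.
rewrite !mxE !gl exchange_big; congr (_ - _); apply: eq_bigr => k _.
by rewrite !mxE mulr_suml gl gr; apply: eq_bigr => l _; rewrite !mxE gl gr.
Qed.

(** * The determinant of the block pattern of a corona *)

(** [b] and [c] ignore the position inside a copy, so a Schur complement sees the inverse of the
    block [d] only through the sum of its entries, which is the coronal. *)
Definition corona_fun (F : fieldType) (S K T : finType) (a : S -> S -> F)
    (b : S -> K -> F) (c : K -> S -> F) (d : T -> T -> F)
    (x y : S + K * T) : F :=
  match x, y with
  | inl u, inl v => a u v
  | inl u, inr (k, _) => b u k
  | inr (k, _), inl v => c k v
  | inr (k, w), inr (l, w') => d w w' *+ (k == l)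
  end.

(* The copies of [T] are eliminated one at a time: each Schur complement keeps
   the shape of [corona_fun], and only changes [a] by a rank one term. *)
Lemma det_corona_fun_ord (F : fieldType) (S T : finType) (m : nat)
    (a : S -> S -> F) (b : S -> 'I_m -> F) (c : 'I_m -> S -> F)
    (d : T -> T -> F) :
  finmx d \in unitmx ->
  \det (finmx (corona_fun a b c d)) = \det (finmx d) ^+ m *
    \det (finmx (fun u v => a u v -
      (\sum_i \sum_j invmx (finmx d) i j) * \sum_k b u k * c k v)).
Proof.
move=> unitd; set chi := \sum_i _.
elim: m a b c => [|m IHm] a b c.
  rewrite expr0 mul1r.
  have bij_h : bijective (inl : S -> S + 'I_0 * T).
    by apply: inj_card_bij => [x y []|] //;
       rewrite card_sum card_prod card_ord addn0.
  rewrite -(det_finmx_bij _ bij_h); congr (\det _); apply/matrixP=> i j.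
  by rewrite !mxE big_ord0 mulr0 subr0.
(* Copy [ord0] is moved to the right summand, the one that [det_finmx_sum] eliminates. *)
pose h (x : (S + 'I_m * T) + T) : S + 'I_m.+1 * T :=
  match x with
  | inl (inl u) => inl u
  | inl (inr (k, w)) => inr (lift ord0 k, w)
  | inr w => inr (ord0, w)
  end.
have bij_h : bijective h.
  apply: inj_card_bij.
    move=> [[u|[k w]]|w] [[v|[l w']]|w'] //= [] //.
    - by move=> ->.
    - by move=> /ord_inj -> ->.
    - by move=> ->.
  by rewrite !card_sum !card_prod !card_ord mulSn addnA addnAC.
rewrite -(det_finmx_bij _ bij_h); set f := fun x y => _.
have Ed : finmx (fun x y => f (inr x) (inr y)) = finmx d.
  by apply/matrixP=> i j; rewrite !mxE.
rewrite det_finmx_sum Ed // exprS -mulrA -/chi.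
transitivity (\det (finmx d) * \det (finmx (corona_fun
  (fun u v => a u v - chi * (b u ord0 * c ord0 v))
  (fun u k => b u (lift ord0 k)) (fun k v => c (lift ord0 k) v) d))).
  congr (_ * \det _); apply/matrixP=> i j; rewrite !mxE /f.
  (* Only the entries on [S] are corrected: [f] vanishes between copy [ord0] and the other
     copies. *)
  case: (enum_val i) (enum_val j) => [u|[k w]] [v|[l w']] /=.
  - congr (_ - _); rewrite mulr_suml; apply: eq_bigr => p _.
    by rewrite mulr_suml; apply: eq_bigr => q _; rewrite mulrAC mulrC.
  - by rewrite big1 ?subr0 // => p _; rewrite big1 // => q _; rewrite mulr0.
  - by rewrite big1 ?subr0 // => p _; rewrite big1 // => q _; rewrite !mul0r.
  - by rewrite big1 ?subr0 // => p _; rewrite big1 // => q _; rewrite !mul0r.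
(* The correction made for copy [ord0] is the first term of the sum over all [m.+1] copies. *)
rewrite IHm; congr (_ * (_ * \det _)); apply/matrixP=> i j; rewrite !mxE.
by rewrite big_ord_recl mulrDr opprD addrA.
Qed.

Lemma det_corona_fun (F : fieldType) (S K T : finType) (a : S -> S -> F)
    (b : S -> K -> F) (c : K -> S -> F) (d : T -> T -> F) :
  finmx d \in unitmx ->
  \det (finmx (corona_fun a b c d)) = \det (finmx d) ^+ #|K| *
    \det (finmx (fun u v => a u v -
      (\sum_i \sum_j invmx (finmx d) i j) * \sum_k b u k * c k v)).
Proof.
move=> unitd; pose h (x : S + 'I_#|K| * T) : S + K * T :=
  match x with inl u => inl u | inr (k, w) => inr (enum_val k, w) end.
have bij_h : bijective h.
  exists (fun x => match x with inl u => inl u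
                   | inr (k, w) => inr (enum_rank k, w) end).
    by case=> [u|[k w]] //=; rewrite enum_valK.
  by case=> [u|[k w]] //=; rewrite enum_rankK.
rewrite -(det_finmx_bij _ bij_h).
transitivity (\det (finmx (corona_fun a
  (fun u (k : 'I_#|K|) => b u (enum_val k)) (fun k v => c (enum_val k) v) d))).
  congr (\det _); apply/matrixP=> i j; rewrite !mxE.
  case: (enum_val i) (enum_val j) => [u|[k w]] [v|[l w']] //=.
  by rewrite (inj_eq enum_val_inj).
rewrite det_corona_fun_ord //; congr (_ * \det _); apply/matrixP=> i j.
rewrite !mxE; congr (_ - _ * _).
by rewrite [RHS](reindex _ (onW_bij _ (enum_val_bij K))).
Qed.

(** * The characteristic matrix of a generic corona *)

Lemma char_mx_Qmx (R : realType) (F : fieldType) (phi : {rmorphism R -> F})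
    (D : digraph) (t : F) :
  t%:M - map_mx phi (Qmx R D) =
  finmx (fun u v => (t - (outdeg u)%:R) *+ (u == v) - (Defs.arc u v)%:R).
Proof.
apply/matrixP=> i j; rewrite !mxE (inj_eq enum_val_inj).
by rewrite rmorphD !rmorphMn rmorph1 opprD addrA mulrnBl.
Qed.

Section GenericCorona.
Variables (D1 D2 : digraph) (K : finType).
Variables (b : D1 -> K -> bool) (c : K -> D1 -> bool) (s : nat).

(** The arc relations of all three coronas are instances of this one by conversion. [b] tells which
    copies a vertex of [D1] points to, [c] which vertices of [D1] a copy points to. *)
Definition corona_rel (x y : D1 + K * D2) : bool :=
  match x, y with
  | inl u, inl v => Defs.arc u v
  | inl u, inr (k, _) => b u k
  | inr (k, _), inl v => c k v
  | inr (k, w), inr (l, w') => (k == l) && Defs.arc w w'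
  end.

Hypothesis irr : irreflexive corona_rel.
Let D := Digraph irr.

Lemma outdeg_corona_inl (u : D1) :
  outdeg (inl u : D) = (outdeg u + #|[set k | b u k]| * #|D2|)%N.
Proof.
rewrite /outdeg -!sum1dep_card big_sumType /=; congr (_ + _)%N.
rewrite big_mkcond (eq_bigr (fun p => if b u p.1 then 1 else 0)%N) => [|[]//].
rewrite -(pair_bigA _ (fun k _ => if b u k then 1 else 0)%N) /=.
rewrite big_distrl /= [RHS]big_mkcond /=; apply: eq_bigr => k _.
by rewrite sum_nat_const mulnC; case: (b u k); rewrite ?mul0n.
Qed.

Lemma outdeg_corona_inr (k : K) (w : D2) :
  outdeg (inr (k, w) : D) = (#|[set v | c k v]| + outdeg w)%N.
Proof.
rewrite /outdeg -!sum1dep_card big_sumType /=; congr (_ + _)%N.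
pose g l w' : nat := if (k == l) && Defs.arc w w' then 1 else 0.
rewrite big_mkcond (eq_bigr (fun p => g p.1 p.2)) => [|[]//].
rewrite -pair_bigA {}/g /=.
rewrite (bigD1 k) //= eqxx [X in (_ + X)%N]big1 ?addn0 -?big_mkcond // => l.
by rewrite eq_sym => /negPf->; rewrite big1.
Qed.

(** Since every copy points to exactly [s] vertices of [D1], all diagonal blocks equal the same [N].
    The matrix [degs] records how many copies each vertex points to, and [E] how many copies give a
    path from one vertex to another. *)
Lemma det_char_mx_corona (R : realType) (F : fieldType)
    (phi : {rmorphism R -> F}) (t : F) (degs E : 'M[R]_#|D1|)
    (N := (t - s%:R)%:M - map_mx phi (Qmx R D2)) :
  N \in unitmx ->
  (forall k, #|[set v | c k v]| = s) ->
  degs = diag_mx (\row_i #|[set k | b (enum_val i) k]|%:R) ->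
  E = \matrix_(i, j) #|[set k | b (enum_val i) k & c k (enum_val j)]|%:R ->
  \det (t%:M - map_mx phi (Qmx R D)) =
    \det N ^+ #|K| *
    \det (t%:M - map_mx phi (Qmx R D1 + #|D2|%:R *: degs)
          - (const_mx 1 *m invmx N *m const_mx 1 : 'M_1) 0 0 *: map_mx phi E).
Proof.
move=> unitN card_c -> ->.
pose a (u v : D1) : F :=
  (t - (outdeg (inl u : D))%:R) *+ (u == v) - (Defs.arc u v)%:R.
(* The minus signs of [B] and [C], as off-diagonal entries of [t - Q], cancel in the products
   counted by [E]. *)
pose B (u : D1) (k : K) : F := - (b u k)%:R.
pose C (k : K) (v : D1) : F := - (c k v)%:R.
pose d (w w' : D2) : F :=
  (t - s%:R - (outdeg w)%:R) *+ (w == w') - (Defs.arc w w')%:R.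
have Ed : finmx d = N by rewrite /N char_mx_Qmx.
have -> : t%:M - map_mx phi (Qmx R D) = finmx (corona_fun a B C d).
  rewrite char_mx_Qmx; apply/matrixP=> i j; rewrite !mxE.
  case: (enum_val i) (enum_val j) => [u|[k w]] [v|[l w']] //=.
  - by rewrite mulr0n sub0r.
  - by rewrite mulr0n sub0r.
  (* The [s] arcs back to [D1] add to the out-degree in [D2], which shifts [t] to [t - s]. *)
  rewrite outdeg_corona_inr card_c natrD opprD addrA /d.
  have -> : (inr (k, w) == inr (l, w') :> D) = (k == l) && (w == w') by [].
  by case: (k == l) => //=; rewrite subr0.
rewrite det_corona_fun Ed //; congr (_ * \det _).
have -> : (const_mx 1 *m invmx N *m const_mx 1 : 'M_1) 0 0
          = \sum_i \sum_j invmx N i j.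
  rewrite mxE exchange_big; apply: eq_bigr => j _; rewrite !mxE mulr1.
  by apply: eq_bigr => i _; rewrite mxE mul1r.
apply/matrixP=> i j; rewrite 2!mxE.
have -> : \sum_k B (enum_val i) k * C k (enum_val j)
          = #|[set k | b (enum_val i) k & c k (enum_val j)]|%:R.
  rewrite -sum1dep_card [X in _ = X%:R]big_mkcond natr_sum; apply: eq_bigr => k _.
  rewrite mulrNN; case: (b _ k) (c k _) => [] [];
  by rewrite /= ?(mulr0, mulr1, mul0r).
rewrite !mxE {}/a (inj_eq enum_val_inj) outdeg_corona_inl natrD natrM.
rewrite !rmorphD rmorphM !rmorphMn rmorph1.
by case: (i == j); rewrite ?mulr1n ?mulr0n; ring.
Qed.

End GenericCorona.

Lemma charpol_corona (R : realType) (D1 D2 : digraph) (K : finType)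
    (b : D1 -> K -> bool) (c : K -> D1 -> bool) (s : nat)
    (irr : irreflexive (corona_rel (D2 := D2) b c)) (degs E : 'M[R]_#|D1|) :
  (forall k, #|[set v | c k v]| = s) ->
  degs = diag_mx (\row_i #|[set k | b (enum_val i) k]|%:R) ->
  E = \matrix_(i, j) #|[set k | b (enum_val i) k & c k (enum_val j)]|%:R ->
  charpol (Qmx R (Digraph irr)) (lambda R) =
    charpol (Qmx R D2) (lambda R - s%:R) ^+ #|K| *
    \det ((lambda R)%:M - liftmx (Qmx R D1 + #|D2|%:R *: degs)
          - coronal (Qmx R D2) (lambda R - s%:R) *: liftmx E).
Proof.
move=> card_c degsE EE; rewrite !charpolE.
exact: (det_char_mx_corona irr (coronal_unitmx _ _) card_c degsE EE).
Qed.

(** * Counting arcs and edges with prescribed ends *)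

(** Copies are indexed by a subtype of pairs or of sets; this turns counts of copies into counts of
    arcs or edges. *)
Lemma card_set_sig (T : finType) (A : {set T}) (P : pred T) :
  #|[set k : {x | x \in A} | P (val k)]| = #|[set x in A | P x]|.
Proof.
rewrite -(card_imset _ val_inj); apply: eq_card => x; rewrite inE.
apply/imsetP/andP => [[k] | [Ax Px]]; first by rewrite inE => Pk ->; rewrite (valP k).
by exists (exist _ x Ax); rewrite ?inE.
Qed.

Lemma card_arcs_source (D : digraph) (u : D) :
  #|[set a in arcs D | u == a.1]| = outdeg u.
Proof.
have inj_f : injective (fun v : D => (u, v)) by move=> v w [].
rewrite /outdeg /indeg -(card_imset _ inj_f); apply: eq_card => -[x y]; rewrite !inE /=.
apply/andP/imsetP => [[xy /eqP->] | [v]]; first by exists y; rewrite ?inE.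
by rewrite inE => uv [-> ->].
Qed.

Lemma card_arcs_target (D : digraph) (v : D) :
  #|[set a in arcs D | v == a.2]| = indeg v.
Proof.
have inj_f : injective (fun u : D => (u, v)) by move=> u w [].
rewrite /outdeg /indeg -(card_imset _ inj_f); apply: eq_card => -[x y]; rewrite !inE /=.
apply/andP/imsetP => [[xy /eqP->] | [u]]; first by exists x; rewrite ?inE.
by rewrite inE => uv [-> ->].
Qed.

Lemma card_arcs_between (D : digraph) (u v : D) :
  #|[set a in arcs D | (u == a.1) && (v == a.2)]| = Defs.arc u v.
Proof.
transitivity #|[set a in [set (u, v)] | Defs.arc u v]|.
  apply: eq_card => -[x y]; rewrite !inE /= xpair_eqE andbC.
  by rewrite (eq_sym u) (eq_sym v); case: eqP => //= ->; case: eqP => //= ->.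
case: (Defs.arc u v).
  by rewrite -[RHS](cards1 (u, v)); apply: eq_card => a; rewrite !inE andbT.
by apply: eq_card0 => a; rewrite !inE andbF.
Qed.

(** Allows the edges at [u] to be counted by their other end. *)
Lemma set2_inj (T : finType) (u : T) : injective (fun v => [set u; v]).
Proof.
move=> v w E; have: v \in [set u; w] by rewrite -E set22.
case/set2P => // vu; have: w \in [set u; v] by rewrite E set22.
by case/set2P => // ->.
Qed.

Lemma card_edge (G : sgraph) (e : {set G}) : e \in edges G -> #|e| = 2.
Proof.
case/imsetP => -[u v]; rewrite inE /= => uv ->; rewrite cards2.
by case: eqP uv => // ->; rewrite adj_irr.
Qed.

Lemma edges_adj (G : sgraph) (u v : G) : ([set u; v] \in edges G) = adj u v.
Proof.
apply/imsetP/idP => [[[x y]] | uv]; last by exists (u, v); rewrite ?inE.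
rewrite inE /= => xy E.
have /set2P[Ex|Ey] : x \in [set u; v] by rewrite E set21.
  by move: E xy; rewrite Ex => /set2_inj->.
by move: E xy; rewrite Ey setUC => /set2_inj->; rewrite adj_sym.
Qed.

Lemma edgeP (G : sgraph) (u : G) (e : {set G}) :
  reflect (exists2 v, adj u v & e = [set u; v]) ((e \in edges G) && (u \in e)).
Proof.
apply: (iffP andP) => [[/imsetP[[x y]]] | [v uv ->]]; last first.
  by rewrite edges_adj set21.
rewrite inE /= => xy -> /set2P[] ->; first by exists y.
by exists x; rewrite 1?adj_sym // setUC.
Qed.

Lemma card_edges_at (G : sgraph) (u : G) :
  #|[set e in edges G | u \in e]| = deg u.
Proof.
rewrite /deg -(card_imset _ (set2_inj (u := u))); apply: eq_card => e; rewrite inE.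
by apply/edgeP/imsetP => -[v uv ->]; exists v; rewrite ?inE // in uv *.
Qed.

(** For [u = v] all edges at [u] count and [adj u u] is false; otherwise the only candidate is the
    edge [{u, v}]. The right-hand side is the entry of the signless Laplacian [gQmx]. *)
Lemma card_edges_between (G : sgraph) (u v : G) :
  #|[set e in edges G | (u \in e) && (v \in e)]|
    = (deg u * (u == v) + adj u v)%N.
Proof.
case: eqP => [<-|/eqP uv].
  rewrite adj_irr muln1 addn0 -card_edges_at.
  by apply: eq_card => e; rewrite !inE andbb.
rewrite muln0 add0n.
transitivity #|[set e in [set [set u; v]] | adj u v]|.
  apply: eq_card => e; rewrite !inE andbA.
  apply/andP/andP => [[/edgeP[w uw ->] /set2P[vu|->]] | [/eqP-> adj_uv]].
  - by rewrite vu eqxx in uv.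
  - by rewrite eqxx uw.
  - by rewrite edges_adj adj_uv set21 set22.
case: (adj u v).
  by rewrite -[RHS](cards1 [set u; v]); apply: eq_card => a; rewrite !inE andbT.
by apply: eq_card0 => a; rewrite !inE andbF.
Qed.

(** * The three coronas as instances of the generic formula *)

Theorem theorem4p11 (R : realType) (D1 D2 : digraph) :
  let G1 := underlying D1 in
  let n2 := #|D2| in
  let m1 := #|arcs D1| in
  let m1' := #|edges G1| in
  let lam := lambda R in
  [/\ charpol (Qmx R (forward_arc_corona D1 D2)) lam =
        charpol (Qmx R D2) (lam - 1) ^+ m1 *
        \det (lam%:M - liftmx (Qmx R D1 + n2%:R *: outdegmx R D1)
              - coronal (Qmx R D2) (lam - 1) *: liftmx (adjmx R D1)),
      charpol (Qmx R (backward_arc_corona D1 D2)) lam =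
        charpol (Qmx R D2) (lam - 1) ^+ m1 *
        \det (lam%:M - liftmx (Qmx R D1 + n2%:R *: indegmx R D1)
              - coronal (Qmx R D2) (lam - 1) *: liftmx (adjmx R D1)^T)
    & charpol (Qmx R (symmetric_arc_corona D1 D2)) lam =
        charpol (Qmx R D2) (lam - 2) ^+ m1' *
        \det (lam%:M - liftmx (Qmx R D1 + n2%:R *: gdegmx R G1)
              - coronal (Qmx R D2) (lam - 2) *: liftmx (gQmx R G1))].
Proof.
have card_arcsE : #|{: {a : D1 * D1 | a \in arcs D1}}| = #|arcs D1|.
  by rewrite card_sig; apply: eq_card.
move=> G1 n2 m1 m1' lam; split.
- rewrite /m1 -card_arcsE.
  (* The only arc from a copy vertex back to [D1] goes to the head of the arc that carries the copy;
     [1%:R] is [1] by conversion. *)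
  apply: (charpol_corona (s := 1)
    (b := fun u (a : {a : D1 * D1 | a \in arcs D1}) => u == (val a).1)
    (c := fun a v => v == (val a).2) (@fwd_arc_irr D1 D2)).
  + by move=> a; rewrite -(cards1 (val a).2); apply: eq_card => v; rewrite !inE.
  + congr diag_mx; apply/matrixP=> i j; rewrite !mxE.
    by rewrite -card_arcs_source -card_set_sig.
  + apply/matrixP=> i j; rewrite !mxE -card_arcs_between.
    by rewrite -(card_set_sig _ (fun a => (_ == a.1) && (_ == a.2))).
- rewrite /m1 -card_arcsE.
  apply: (charpol_corona (s := 1)
    (b := fun v (a : {a : D1 * D1 | a \in arcs D1}) => v == (val a).2)
    (c := fun a u => u == (val a).1) (@bwd_arc_irr D1 D2)).
  + by move=> a; rewrite -(cards1 (val a).1); apply: eq_card => v; rewrite !inE.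
  + congr diag_mx; apply/matrixP=> i j; rewrite !mxE.
    by rewrite -card_arcs_target -card_set_sig.
  (* With the ends exchanged, entry [(i, j)] counts arcs from [j] to [i], whence the transpose. *)
  + apply/matrixP=> i j; rewrite !mxE -card_arcs_between.
    rewrite -(card_set_sig _ (fun a => (_ == a.1) && (_ == a.2))).
    by congr _%:R; apply: eq_card => a; rewrite !inE andbC.
- have <- : #|{: {e : {set D1} | e \in edges G1}}| = m1'.
    by rewrite card_sig; apply: eq_card.
  (* Here a copy vertex points back to both ends of its edge, which are distinct. *)
  apply: (charpol_corona (s := 2)
    (b := fun u (e : {e : {set D1} | e \in edges G1}) => u \in val e)
    (c := fun e u => u \in val e) (@sym_arc_irr D1 D2)).
  + by move=> e; apply: etrans (card_edge (valP e)); apply: eq_card => v; rewrite !inE.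
  + congr diag_mx; apply/matrixP=> i j; rewrite !mxE.
    by rewrite -card_edges_at -card_set_sig.
  + apply/matrixP=> i j; rewrite !mxE.
    rewrite (card_set_sig (edges G1) (fun e => (_ \in e) && (_ \in e))).
    by rewrite card_edges_between natrD natrM mulr_natr (inj_eq enum_val_inj).
Qed.
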